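(* Let $(b_n)_{n\ge1}$, $(c_n)_{n\ge0}$ be real sequences with $c_n\neq0$, $b_n\neq0$ for every $n$. Let $(A_n)_{n\ge0}$, $(B_n)_{n\ge0}$ be two linearly independent rational-valued solutions of $$c_ny_{n+1}+c_{n-1}y_{n-1}-b_ny_n=0,\qquad n\ge1,$$ such that $\lim_{n\to\infty}B_n/A_n=L$, where $L$ is irrational. Then $L$ is algebraic of degree two over $\mathbb{Q}$ if and only if the four-term recurrence relation $$c_{n+2}c_{n+1}^2b_n\,z_{n+2}+\big(b_nc_{n+1}^3-b_nb_{n+1}b_{n+2}c_{n+1}\big)z_{n+1}+\big(b_nb_{n+1}b_{n+2}c_n-b_{n+2}c_n^3\big)z_n-c_{n-1}c_n^2b_{n+2}\,z_{n-1}=0,\qquad n\ge1,$$ has a non-trivial rational-valued solution $(S_n)$ such that $S_n/(A_nA_{n-1})\to0$ as $n\to\infty$.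
   Formalization: The condition S_n/(A_nA_{n-1})→0 is read with the index corrected: for a solution (z_n) of the four-term recurrence it is z_n/(A_{n+1}A_n)→0 (that is, S_n=z_{n-1}); with S_n=z_n the printed claim is false. *)

(* Defs.v *)
From HB Require Import structures.
From mathcomp Require Import all_boot all_order all_algebra.
From mathcomp Require Import all_classical all_reals all_analysis.
Set Implicit Arguments.
Unset Strict Implicit.
Unset Printing Implicit Defensive.
Import Order.TTheory GRing.Theory Num.Theory.
Import numFieldNormedType.Exports.
Local Open Scope classical_set_scope.
Local Open Scope ring_scope.

(* The sequence b is only meaningful from index 1 on: b 0 is never used. *)
Definition three_term_sol (R : realType) (b c y : nat -> R) : Prop :=
  forall n : nat, (0 < n)%N ->
    c n * y n.+1 + c n.-1 * y n.-1 - b n * y n = 0.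

(* If y and y' solve three_term_sol, then z n := y n.+1 * y' n + y n * y' n.+1
   solves this recurrence: the term z n belongs to the pair of indices
   (n, n.+1), not (n.-1, n). *)
Definition four_term_sol (R : realType) (b c z : nat -> R) : Prop :=
  forall n : nat, (0 < n)%N ->
    c n.+2 * c n.+1 ^+ 2 * b n * z n.+2
    + (b n * c n.+1 ^+ 3 - b n * b n.+1 * b n.+2 * c n.+1) * z n.+1
    + (b n * b n.+1 * b n.+2 * c n - b n.+2 * c n ^+ 3) * z n
    - c n.-1 * c n ^+ 2 * b n.+2 * z n.-1 = 0.

Definition linearly_independent2 (R : realType) (u v : nat -> R) : Prop :=
  forall s t : R, (forall n : nat, s * u n + t * v n = 0) -> s = 0 /\ t = 0.

Definition is_minpoly_rat (R : realType) (x : R) (p : {poly rat}) : Prop :=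
  [/\ p \is monic, irreducible_poly p & root (map_poly ratr p) x].

Definition algebraic_of_degree (R : realType) (d : nat) (x : R) : Prop :=
  exists p : {poly rat}, is_minpoly_rat x p /\ size p = d.+1.

(* Main.v *)
Require Import Defs.
From HB Require Import structures.
From mathcomp Require Import all_boot all_order all_algebra.
From mathcomp Require Import all_classical all_reals all_analysis.
From mathcomp Require Import ring.
Set Implicit Arguments.
Unset Strict Implicit.
Unset Printing Implicit Defensive.
Import Order.TTheory GRing.Theory Num.Theory.
Import numFieldNormedType.Exports.
Local Open Scope classical_set_scope.
Local Open Scope ring_scope.

(* The sequences al A_{n+1} A_n + be (A_{n+1} B_n + A_n B_{n+1}) + ga B_{n+1} B_n
   with al, be, ga rational are exactly the rational solutions of the four-term
   recurrence: that recurrence has order three, and the three products are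
   independent at n = 0, 1, 2.  Divided by A_{n+1} A_n, such a solution tends to
   al + 2 be L + ga L^2, so it is negligible exactly when L is a root of this
   rational quadratic. *)

Definition quad_step (F : fieldType) (al be ga : F) (y y' : nat -> F) (n : nat) : F :=
  al * (y n.+1 * y n) + be * (y n.+1 * y' n + y n * y' n.+1)
  + ga * (y' n.+1 * y' n).

Lemma ratr_quad_step (R : realType) (al be ga : rat) (y y' : nat -> rat) n :
  ratr (quad_step al be ga y y' n) =
  quad_step (ratr al) (ratr be) (ratr ga) (fun n => ratr (y n)) (fun n => ratr (y' n)) n
  :> R.
Proof. by rewrite /quad_step !(rmorphD, rmorphM). Qed.

Section Recurrences.
Variables (R : realType) (b c : nat -> R).
Hypothesis hc : forall n : nat, c n != 0.

Lemma three_term_step y n : three_term_sol b c y ->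
  y n.+2 = (b n.+1 * y n.+1 - c n * y n) / c n.+1.
Proof.
move=> /(_ n.+1 isT) /= /subr0_eq <-; rewrite addrK mulrC mulKf //.
Qed.

Lemma three_term_sol_eq0 y : three_term_sol b c y -> y 0%N = 0 -> y 1%N = 0 ->
  forall n, y n = 0.
Proof.
move=> hy y0 y1 n.
suff: y n = 0 /\ y n.+1 = 0 by case.
by elim: n => [//|n [yn yn1]]; split=> //;
  rewrite (three_term_step n hy) yn yn1 !mulr0 subr0 mul0r.
Qed.

(** The coefficient of the highest term is a product of non-zero values of [b] and [c], so three
    consecutive terms determine the next one. *)
Lemma four_term_sol_inj z z' : (forall n : nat, (0 < n)%N -> b n != 0) ->
  four_term_sol b c z -> four_term_sol b c z' ->
  z 0%N = z' 0%N -> z 1%N = z' 1%N -> z 2%N = z' 2%N -> z =1 z'.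
Proof.
move=> hb hz hz' e0 e1 e2 n.
suff: [/\ z n = z' n, z n.+1 = z' n.+1 & z n.+2 = z' n.+2] by case.
elim: n => [//|n [en en1 en2]]; split=> //.
have lead : c n.+3 * c n.+2 ^+ 2 * b n.+1 != 0.
  by rewrite !mulf_neq0 ?expf_neq0 ?hb.
apply: (mulfI lead); have := hz n.+1 isT; rewrite -(hz' n.+1 isT) /= en en1 en2.
by do 3 move/addIr.
Qed.

Lemma quad_step_four_term al be ga y y' :
  three_term_sol b c y -> three_term_sol b c y' ->
  four_term_sol b c (quad_step al be ga y y').
Proof.
move=> hy hy' [//|n] _; rewrite /quad_step /=.
(* Everything is reduced to the indices [n.+1] and [n.+2]: forwards from [n.+4] and [n.+3],
   backwards from [n] through [back]. What remains is an identity of rational functions whose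
   denominators are values of [c]. *)
rewrite !(three_term_step n.+2 hy, three_term_step n.+2 hy').
rewrite !(three_term_step n.+1 hy, three_term_step n.+1 hy').
have back u : three_term_sol b c u -> u n = (b n.+1 * u n.+1 - c n.+1 * u n.+2) / c n.
  by move=> hu; rewrite (three_term_step n hu); field; rewrite !hc.
rewrite (back y) // (back y') //; field.
by rewrite !hc.
Qed.

Lemma casoratian0_neq0 (y y' : nat -> R) :
  three_term_sol b c y -> three_term_sol b c y' -> linearly_independent2 y y' ->
  y 0%N * y' 1%N - y 1%N * y' 0%N != 0.
Proof.
move=> hy hy' ind; apply/eqP => D0.
have comb s t : s * y 0%N + t * y' 0%N = 0 -> s * y 1%N + t * y' 1%N = 0 ->
    s = 0 /\ t = 0.
  move=> e0 e1; apply: ind; apply: three_term_sol_eq0 => // -[//|n] _ /=.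
  rewrite (three_term_step n hy) (three_term_step n hy').
  by field.
(* Since the determinant vanishes, [y' 0 * y - y 0 * y'] is zero at both initial indices, hence
   everywhere, and independence kills its coefficients. The same is then done with the values at
   1. *)
have [||y'0 /eqP] := comb (y' 0%N) (- y 0%N).
- by ring.
- by rewrite -[RHS]oppr0 -D0; ring.
rewrite oppr_eq0 => /eqP y0.
have [||y'1 /eqP] := comb (y' 1%N) (- y 1%N).
- by rewrite -[RHS]D0; ring.
- by ring.
rewrite oppr_eq0 => /eqP y1.
(* Now [y] vanishes at 0 and 1, so [1 * y + 0 * y'] is a forbidden relation. *)
have [||/eqP] := comb 1 0; rewrite ?y0 ?y1 ?mulr0 ?mul0r ?addr0 //.
by rewrite oner_eq0.
Qed.

(* The product of the three Casoratians [y_1,y_2] [y_0,y_2] [y_1,y_3] is the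
   determinant of the quadratic forms l_0 l_1, l_1 l_2, l_2 l_3, where l_i is
   the linear form with coefficients (y_i, y'_i). *)
Lemma casoratians_neq0 (y y' : nat -> R) :
  (forall n : nat, (0 < n)%N -> b n != 0) ->
  three_term_sol b c y -> three_term_sol b c y' -> linearly_independent2 y y' ->
  (y 1%N * y' 2%N - y 2%N * y' 1%N) * (y 0%N * y' 2%N - y 2%N * y' 0%N)
  * (y 1%N * y' 3%N - y 3%N * y' 1%N) != 0.
Proof.
move=> hb hy hy' ind.
rewrite !(three_term_step 1 hy, three_term_step 1 hy').
rewrite !(three_term_step 0 hy, three_term_step 0 hy').
set D := y 0%N * y' 1%N - y 1%N * y' 0%N.
(* By the recurrence each of the three Casoratians is a non-zero multiple of the initial one,
   [D]. *)
rewrite [X in X != 0](_ : _ = (c 0%N / c 1%N) * D * (b 1%N / c 1%N * D)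
    * (b 2%N / c 2%N * (c 0%N / c 1%N) * D)); last first.
  by rewrite /D; field; rewrite !hc.
by rewrite !mulf_neq0 ?invr_eq0 ?hb // casoratian0_neq0.
Qed.

End Recurrences.

Section QuadStepInitial.
Variables (F : fieldType) (y y' : nat -> F).
Let D := (y 1%N * y' 2%N - y 2%N * y' 1%N) * (y 0%N * y' 2%N - y 2%N * y' 0%N)
  * (y 1%N * y' 3%N - y 3%N * y' 1%N).
Hypothesis D_neq0 : D != 0.

Lemma quad_step_interpolation (z0 z1 z2 : F) :
  exists al be ga, [/\ quad_step al be ga y y' 0 = z0,
    quad_step al be ga y y' 1 = z1 & quad_step al be ga y y' 2 = z2].
Proof.
(* Cramer's rule for the 3 by 3 system with columns [u], [v], [w] and determinant [D]; [m] denotes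
   its 2 by 2 minors. *)
pose u n := y n.+1 * y n.
pose v n := y n.+1 * y' n + y n * y' n.+1.
pose w n := y' n.+1 * y' n.
pose m (f g : nat -> F) (i j : nat) := f i * g j - f j * g i.
exists ((z0 * m v w 1%N 2%N - z1 * m v w 0%N 2%N + z2 * m v w 0%N 1%N) / D).
exists ((- z0 * m u w 1%N 2%N + z1 * m u w 0%N 2%N - z2 * m u w 0%N 1%N) / D).
exists ((z0 * m u v 1%N 2%N - z1 * m u v 0%N 2%N + z2 * m u v 0%N 1%N) / D).
have div a1 a2 a3 x1 x2 x3 z : a1 * x1 + a2 * x2 + a3 * x3 = z * D ->
    a1 / D * x1 + a2 / D * x2 + a3 / D * x3 = z.
  by move=> e; rewrite -[RHS](mulfK D_neq0) -e; ring.
by rewrite /quad_step; split; apply: div; rewrite /m /u /v /w /D; ring.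
Qed.

(** Combining the three equations with the cofactors of the third column eliminates [al] and [be]
    and leaves [ga * D]. *)
Lemma quad_step_eq0_lead (al be ga : F) : quad_step al be ga y y' 0 = 0 ->
  quad_step al be ga y y' 1 = 0 -> quad_step al be ga y y' 2 = 0 -> ga = 0.
Proof.
move=> e0 e1 e2; apply: (mulIf D_neq0); rewrite mul0r.
pose u n := y n.+1 * y n.
pose v n := y n.+1 * y' n + y n * y' n.+1.
pose m (f g : nat -> F) (i j : nat) := f i * g j - f j * g i.
transitivity (quad_step al be ga y y' 0 * m u v 1%N 2%N
  - quad_step al be ga y y' 1 * m u v 0%N 2%N
  + quad_step al be ga y y' 2 * m u v 0%N 1%N).
  by rewrite /quad_step /m /u /v /D; ring.
by rewrite e0 e1 e2 !mul0r subr0 addr0.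
Qed.

End QuadStepInitial.

Lemma cvg_quad_step (R : realType) (al be ga L : R) (y y' : nat -> R) :
  (fun n => y' n / y n) @ \oo --> L -> L != 0 ->
  (fun n => quad_step al be ga y y' n / (y n.+1 * y n)) @ \oo -->
    al + be * (L + L) + ga * (L * L).
Proof.
move=> hlim L0.
have hlimS : (fun n => y' n.+1 / y n.+1) @ \oo --> L.
  by move: hlim; rewrite -cvg_shiftS.
(* As [0^-1 = 0], the quotient is 0 wherever [y] vanishes; near the non-zero limit this cannot
   happen. *)
have y_neq0 : \forall n \near \oo, y n != 0.
  apply: filterS (cvgr_neq0 L hlim L0) => n.
  by apply: contra_neq => ->; rewrite invr0 mulr0.
have yS_neq0 : \forall n \near \oo, y n.+1 != 0.
  apply: filterS (cvgr_neq0 L hlimS L0) => n.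
  by apply: contra_neq => ->; rewrite invr0 mulr0.
apply: cvg_trans (_ : (fun n => al + be * (y' n / y n + y' n.+1 / y n.+1)
    + ga * (y' n.+1 / y n.+1 * (y' n / y n))) @ \oo --> _); last first.
  apply: cvgD; first apply: cvgD; first exact: cvg_cst.
    by apply: cvgM; [exact: cvg_cst | exact: cvgD].
  by apply: cvgM; [exact: cvg_cst | exact: cvgM].
apply: near_eq_cvg; near=> n.
have yn : y n != 0 by near: n.
have ySn : y n.+1 != 0 by near: n.
by rewrite /quad_step; field; rewrite yn ySn.
Unshelve. all: by end_near. Qed.

Lemma irrational_ratrP (R : realType) (L : R) (q : rat) : irrational L -> L != ratr q.
Proof. by move=> hL; apply/eqP => e; apply: hL; exists q. Qed.

Lemma irrational_degree2P (R : realType) (L : R) : irrational L ->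
  algebraic_of_degree 2 L <->
  exists p q : rat, L ^+ 2 + ratr p * L + ratr q = 0.
Proof.
move=> hL; split=> [[P [[Pm _ Pr] sP]] | [p [q e]]].
  exists P`_1, P`_0; move: Pr; rewrite /root horner_coef size_map_poly sP => /eqP <-.
  rewrite !big_ord_recl big_ord0 /= !coef_map /=.
  have -> : P`_(bump 0 (bump 0 0)) = 1.
    by move: Pm => /monicP; rewrite /lead_coef sP.
  by rewrite rmorph1; ring.
pose P : {poly rat} := 'X^2 + (p *: 'X + q%:P).
have sz : (size (p *: 'X + q%:P)%R < size ('X^2 : {poly rat})%R)%N.
  rewrite size_polyXn (leq_ltn_trans (size_polyD _ _)) // gtn_max.
  rewrite (leq_ltn_trans (size_scale_leq _ _)) ?size_polyX //.
  by rewrite (leq_ltn_trans (size_polyC_leq1 _)).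
have sP : size P = 3 by rewrite /P size_polyDl // size_polyXn.
exists P; split=> //; split.
- by rewrite monicE /P lead_coefDl // lead_coefXn.
- apply: cubic_irreducible; first by rewrite sP.
  move=> r; apply/negP; rewrite /root /P !hornerE => /eqP /= er.
  (* A rational root [r] would make the second root [- p - r] rational too, and [L] is one of the
     two. *)
  have : (L - ratr r) * (L - ratr (- p - r)) = 0.
    rewrite -e (_ : q = - (r ^+ 2 + p * r)).
      by rewrite !(rmorphB, rmorphD, rmorphN, rmorphM, rmorphXn) /=; ring.
    by rewrite -[LHS]subr0 -er; ring.
  by move/eqP; rewrite mulf_eq0 !subr_eq0 !(negPf (irrational_ratrP _ hL)).
- rewrite /root /P !rmorphD /= linearZ /= map_polyXn map_polyX map_polyC /=.
  by rewrite !hornerE /= e.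
Qed.

Theorem theorem3p5 (R : realType) (b c : nat -> R) (A B : nat -> rat) (L : R)
    (hc : forall n : nat, c n != 0)
    (hb : forall n : nat, (0 < n)%N -> b n != 0)
    (hA : three_term_sol b c (fun n => ratr (A n)))
    (hB : three_term_sol b c (fun n => ratr (B n)))
    (hAB : linearly_independent2 (fun n => ratr (A n) : R)
                                 (fun n => ratr (B n) : R))
    (hlim : (fun n => ratr (B n) / ratr (A n) : R) @ \oo --> L)
    (hL : irrational L) :
  algebraic_of_degree 2 L <->
  exists z : nat -> rat,
    [/\ four_term_sol b c (fun n => ratr (z n)),
        exists n : nat, z n != 0
      & (fun n => ratr (z n) / (ratr (A n.+1) * ratr (A n)) : R) @ \oo --> (0 : R)].
Proof.
(* The determinant is brought down to [rat], so that interpolation yields rational coefficients. *)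
have D_neq0 : (A 1%N * B 2%N - A 2%N * B 1%N) * (A 0%N * B 2%N - A 2%N * B 0%N)
    * (A 1%N * B 3%N - A 3%N * B 1%N) != 0.
  have := casoratians_neq0 hc hb hA hB hAB.
  by rewrite -!(rmorphM, rmorphB) fmorph_eq0.
have L0 : L != 0 by rewrite -(rmorph0 (@ratr R)) irrational_ratrP.
rewrite (irrational_degree2P hL); split=> [[p [q e]] | [z [hz [k zk] z0]]].
  (* The limit [al + 2 be L + ga L^2] becomes [q + p L + L^2 = 0]; the sequence is non-trivial
     because [ga = 1]. *)
  exists (quad_step q (p / 2) 1 A B); split.
  - rewrite (funext (ratr_quad_step R q (p / 2) 1 A B)).
    exact: quad_step_four_term.
  - apply: contrapT => none.
    have all0 n : quad_step q (p / 2) 1 A B n = 0.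
      by apply/eqP/negP => /negP nz; apply: none; exists n.
    have /eqP := quad_step_eq0_lead D_neq0 (all0 0%N) (all0 1%N) (all0 2%N).
    by rewrite oner_eq0.
  - rewrite (_ : 0 = ratr q + ratr (p / 2)%R * (L + L) + ratr 1%R * (L * L)).
      under eq_fun do rewrite ratr_quad_step.
      exact: cvg_quad_step.
    by rewrite -e fmorph_div rmorph1 (rmorph_nat (@ratr R) 2); field.
(* A rational combination agreeing with [z] at 0, 1, 2 agrees with it everywhere, by uniqueness for
   the four-term recurrence. *)
have [al [be [ga [e0 e1 e2]]]] := quad_step_interpolation D_neq0 (z 0%N) (z 1%N) (z 2%N).
have zE : z =1 quad_step al be ga A B.
  move=> n; apply: (fmorph_inj (@ratr R)); move: n.
  apply: (four_term_sol_inj hc hb hz); rewrite ?e0 ?e1 ?e2 //.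
  rewrite (funext (ratr_quad_step R al be ga A B)).
  exact: quad_step_four_term.
have root_L : ratr al + ratr be * (L + L) + ratr ga * (L * L) = 0.
  move: z0; under eq_fun do rewrite zE ratr_quad_step.
  have := @cvg_quad_step _ (ratr al) (ratr be) (ratr ga) _ _ _ hlim L0.
  exact: (cvg_unique (@norm_hausdorff _ _)).
have [ga0|ga0] := eqVneq ga 0; last first.
  exists (2 * be / ga), (al / ga).
  have rga0 : ratr ga != 0 :> R by rewrite fmorph_eq0.
  apply: (mulfI rga0); rewrite mulr0 -root_L !fmorph_div rmorphM (rmorph_nat (@ratr R) 2).
  by field.
(* In the degenerate case [al + 2 be L = 0]: either [be = 0], then [al = 0] and [z] is trivial, or
   [L] is the rational [- al / (2 * be)]. *)
move: root_L; rewrite ga0 rmorph0 mul0r addr0.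
have [be0|be0] := eqVneq be 0.
  rewrite be0 rmorph0 mul0r addr0 => /eqP; rewrite fmorph_eq0 => /eqP al0.
  by move: zk; rewrite zE /quad_step al0 be0 ga0 !mul0r !addr0 eqxx.
have rbe0 : ratr be != 0 :> R by rewrite fmorph_eq0.
move=> root_L; have /eqP[] := irrational_ratrP (- al / (2 * be)) hL.
rewrite fmorph_div rmorphN rmorphM (rmorph_nat (@ratr R) 2) /=.
have -> : ratr al = - (ratr be * (L + L)) :> R.
  by apply/eqP; rewrite -addr_eq0 root_L.
by field.
Qed.
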